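(* Let $q$ be a root of unity, $p\geq3$ the smallest positive integer with $q^p=1$, and $p'=p$ if $p$ is odd, $p'=p/2$ if $p$ is even. The representations $R_n^{(\mathrm i,+)}$, $R_n^{(\mathrm i,-)}$, $R_n^{(-\mathrm i,+)}$, $R_n^{(-\mathrm i,-)}$ of $U_q(\mathrm{so}_3)$, where $n=1,2,3,\dots,\frac{p'}2$ if $p'$ is even and $n=1,2,3,\dots,\frac{p'-1}2$ if $p'$ is odd, are irreducible and pairwise nonequivalent. For any $l\in\{0,\frac12,1,\frac32,\dots,\frac{p'-1}2\}$, the representation $R_l^{(1)}$ is not equivalent to any of these representations.
   Context: A square root $q^{1/2}$ is fixed; $\mathrm i=\sqrt{-1}$; $[a]=\frac{q^a-q^{-a}}{q-q^{-1}}$. $U_q(\mathrm{so}_3)$ is the unital associative complex algebra generated by $I_1,I_2,I_3$ with defining relations $q^{1/2}I_1I_2-q^{-1/2}I_2I_1=I_3$, $q^{1/2}I_2I_3-q^{-1/2}I_3I_2=I_1$, $q^{1/2}I_3I_1-q^{-1/2}I_1I_3=I_2$. A representation $R$ is determined by $R(I_1)$ and $R(I_2)$, since $R(I_3)=q^{1/2}R(I_1)R(I_2)-q^{-1/2}R(I_2)R(I_1)$. $R_l^{(1)}$ acts on the space with basis $|m\rangle$, $m=-l,-l+1,\dots,l$, by $R_l^{(1)}(I_1)|m\rangle=\mathrm i[m]\,|m\rangle$, $R_l^{(1)}(I_2)|m\rangle=\frac{1}{q^m+q^{-m}}\{[l-m]\,|m+1\rangle-[l+m]\,|m-1\rangle\}$.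 The representations $R_n^{(\pm\mathrm i,\pm)}$ act on the $n$-dimensional space with basis $|1\rangle,\dots,|n\rangle$ by (terms with the vector $|n+1\rangle$ have coefficient $[0]=0$) $$R_n^{(\mathrm i,\pm)}(I_1)|k\rangle=-\frac{q^{k-1/2}+q^{-k+1/2}}{q-q^{-1}}|k\rangle,$$ $$R_n^{(\mathrm i,\pm)}(I_2)|1\rangle=\pm\frac{[n]}{q^{1/2}-q^{-1/2}}|1\rangle+\mathrm i\frac{[n-1]}{q^{1/2}-q^{-1/2}}|2\rangle,$$ $$R_n^{(\mathrm i,\pm)}(I_2)|k\rangle=\mathrm i\frac{[n-k]}{q^{k-1/2}-q^{-k+1/2}}|k+1\rangle+\mathrm i\frac{[n+k-1]}{q^{k-1/2}-q^{-k+1/2}}|k-1\rangle,\quad k\ne1,$$ and $R_n^{(-\mathrm i,\pm)}(I_1)=-R_n^{(\mathrm i,\pm)}(I_1)$, $R_n^{(-\mathrm i,\pm)}(I_2)=-R_n^{(\mathrm i,\pm)}(I_2)$. *)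

(* Defs.v *)
(* The definitions make sense over any numClosedFieldType C; the complex numbers
   are the instance C = R[i] with R : realType. *)
From HB Require Import structures.
From mathcomp Require Import all_boot all_order all_algebra.
From mathcomp Require Import reals.
From mathcomp Require Export complex.

Set Implicit Arguments.
Unset Strict Implicit.
Unset Printing Implicit Defensive.

Import Order.TTheory GRing.Theory Num.Theory.
Local Open Scope ring_scope.

Section Uqso3.

Variable C : numClosedFieldType.

(* Throughout, s stands for the fixed square root q^(1/2), so that q = s ^ 2,
   and half-integers are passed doubled: s ^ d is q^(d/2). *)
Variable s : C.

(* qnum d is [d/2]. *)
Definition qnum (d : int) : C := (s ^ d - s ^ (- d)) / (s ^ 2 - s ^ (- 2)).

(* Images of the generators I_1, I_2, I_3. Matrices act on column vectors:
   A i j is the coefficient of the i-th basis vector in the image of the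
   j-th, so that A *m B is the composite "A after B". *)
Record operators (n : nat) := Operators {
  op1 : 'M[C]_n;
  op2 : 'M[C]_n;
  op3 : 'M[C]_n }.

Definition qcomm n (A B : 'M[C]_n) : 'M[C]_n :=
  s *: (A *m B) - s^-1 *: (B *m A).

(* U_q(so_3) is presented by generators and relations, so its representations
   on C^n are the triples of operators satisfying the defining relations. *)
Definition is_representation n (r : operators n) : Prop :=
  [/\ qcomm (op1 r) (op2 r) = op3 r,
      qcomm (op2 r) (op3 r) = op1 r
    & qcomm (op3 r) (op1 r) = op2 r].

Definition invariant n (r : operators n) (U : {vspace 'cV[C]_n}) : Prop :=
  forall v, v \in U ->
    [/\ op1 r *m v \in U, op2 r *m v \in U & op3 r *m v \in U].

Definition irreducible_rep n (r : operators n) : Prop :=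
  (0 < n)%N /\
  forall U : {vspace 'cV[C]_n}, invariant r U -> U = 0%VS \/ U = fullv.

Definition equivalent_rep m n (r : operators m) (r' : operators n) : Prop :=
  exists (T : 'M[C]_(n, m)) (T' : 'M[C]_(m, n)),
    [/\ T' *m T = 1%:M, T *m T' = 1%:M
      & [/\ T *m op1 r = op1 r' *m T,
            T *m op2 r = op2 r' *m T
          & T *m op3 r = op3 r' *m T]].

Definition of_op12 n (A B : 'M[C]_n) : operators n :=
  Operators A B (qcomm A B).

(* R_l^(1) with L = 2l. The index j = 0, ..., L stands for |m> with
   m = j - l, and wt L j = 2m. *)
Definition wt (L j : nat) : int := (2 * j)%:Z - L%:Z.

Definition R1_I1 (L : nat) : 'M[C]_L.+1 :=
  \matrix_(i, j) (if i == j then 'i * qnum (wt L j) else 0).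

Definition R1_I2 (L : nat) : 'M[C]_L.+1 :=
  \matrix_(i, j)
    (if i == j.+1 :> nat then
       qnum (L%:Z - wt L j) / (s ^ wt L j + s ^ (- wt L j))
     else if j == i.+1 :> nat then
       - qnum (L%:Z + wt L j) / (s ^ wt L j + s ^ (- wt L j))
     else 0).

Definition R1 (L : nat) : operators L.+1 := of_op12 (R1_I1 L) (R1_I2 L).

(* The index j = 0, ..., n-1 stands for |k> with k = j + 1, and
   hwt j = 2k - 1, so that s ^ hwt j = q^(k - 1/2). *)
Definition hwt (j : nat) : int := (2 * j + 1)%:Z.

Definition Ri_I1 (n : nat) : 'M[C]_n :=
  \matrix_(i, j)
    (if i == j then - ((s ^ hwt j + s ^ (- hwt j)) / (s ^ 2 - s ^ (- 2)))
     else 0).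

(* The sign b is that of the diagonal entry at |1>, with false for + and
   true for -. The coefficient of |2> in the image of |1> is the case k = 1
   of the general coefficient of |k+1>. *)
Definition Ri_I2 (n : nat) (b : bool) : 'M[C]_n :=
  \matrix_(i, j)
    (if i == j.+1 :> nat then
       'i * (qnum (2 * (n%:Z - j.+1%:Z)) / (s ^ hwt j - s ^ (- hwt j)))
     else if j == i.+1 :> nat then
       'i * (qnum (2 * (n%:Z + j.+1%:Z - 1)) / (s ^ hwt j - s ^ (- hwt j)))
     else if (i == 0%N :> nat) && (j == 0%N :> nat) then
       (-1) ^+ b * (qnum (2 * n%:Z) / (s - s^-1))
     else 0).

(* R_n^(i,+-) for a = false, R_n^(-i,+-) for a = true. *)
Definition Ri (n : nat) (a b : bool) : operators n :=
  of_op12 ((-1) ^+ a *: Ri_I1 n) ((-1) ^+ a *: Ri_I2 n b).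

End Uqso3.

Definition pprime (p : nat) : nat := if odd p then p else p./2.

Definition nmax (p : nat) : nat :=
  if odd (pprime p) then (pprime p).-1./2 else (pprime p)./2.

(* Main.v *)
Require Import Defs.
From HB Require Import structures.
From mathcomp Require Import all_boot all_order all_algebra.
From mathcomp Require Import reals.
From mathcomp Require Import complex.
From mathcomp Require Import ring zify.

Set Implicit Arguments.
Unset Strict Implicit.
Unset Printing Implicit Defensive.

Import Order.TTheory GRing.Theory Num.Theory.
Local Open Scope ring_scope.

(** Write c = q + q^(-1).

    Relations. In every family I_1 is diagonal and I_2 is tridiagonal. Once I_3
    is eliminated, the two remaining relations are the cubic ones
      c I_2 I_1 I_2 - (I_2^2 I_1 + I_1 I_2^2) = I_1,
      c I_1 I_2 I_1 - (I_1^2 I_2 + I_2 I_1^2) = I_2.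
    Off the diagonal they hold because consecutive eigenvalues of I_1 satisfy a
    three-term linear recurrence and a quadratic identity, whatever the entries
    of I_2 are; on the diagonal there remains one scalar identity per basis
    vector, which links neighbouring entries of I_2
    (tridiagonal_representation). The extra entry of I_2 at |1> in R_n^(i,+-)
    fits in since q^(k-1/2) + q^(-k+1/2) takes the same value at k = 0 and
    k = 1: |1> behaves as its own lower neighbour. For the representations at
    hand everything becomes an identity of rational functions of q^(1/2), of
    q^(k-1/2) or q^m, and of q^n or q^l.

    Irreducibility. For n <= p'/2 the eigenvalues of I_1 in R_n^(+-i,+-) are
    distinct, so an invariant subspace that is not zero contains a basis
    vector; the entries of I_2 beside the diagonal do not vanish, so it contains
    the neighbours of this vector, and in the end all basis vectors
    (irreducible_diagonal_neighbours).

    Nonequivalence. Traces and dimension are enough. The sum of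
    q^(k-1/2) + q^(-k+1/2) over k = 1, ..., n telescopes to
    (q^n - q^(-n))/(q^(1/2) - q^(-1/2)), so with
    t = [n]/(q^(1/2) - q^(-1/2)), which is nonzero in the given range of n, the
    traces of I_1 and I_2 in R_n^(+-i,+-) are t and t up to sign, and the two
    signs determine the representation among those of dimension n. In R_l^(1)
    the trace of I_2 is zero (Ri_traces, trace_R1_I2). *)

(** * Tridiagonal representations *)

Section Tridiagonal.

Variable C : numClosedFieldType.

Definition diagonal n (lam : nat -> C) : 'M[C]_n :=
  \matrix_(i, j) (if i == j then lam j else 0).

(** The entries are functions on nat, so that the neighbours of an index are
    plain successors and predecessors, also beyond the size of the matrix. *)
Definition tridiag_entry (u d : nat -> C) (e : C) (i j : nat) : C :=
  if i == j.+1 then u j else if j == i.+1 then d j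
  else if (i == 0%N) && (j == 0%N) then e else 0.

Definition tridiagonal n (u d : nat -> C) (e : C) : 'M[C]_n :=
  \matrix_(i, j) tridiag_entry u d e i j.

Lemma diagonalE n lam : diagonal n lam = diag_mx (\row_j lam (j : 'I_n)).
Proof.
by apply/matrixP => i j; rewrite !mxE; case: (i =P j) => [->|_].
Qed.

(** Since u vanishes at the last index, column j of the matrix may be read as if
    the row j.+1 were always present. *)
Lemma sum_tridiagonal n (u d : nat -> C) (e : C) (F : nat -> C) (j : 'I_n) :
    u n.-1 = 0 ->
  \sum_(k < n) F k * tridiag_entry u d e k j =
  F j.+1 * u j + (if j : nat is j'.+1 then F j' * d j else F 0%N * e).
Proof.
move=> un0; have pick (m : nat) (x : C) : (m < n)%N ->
    \sum_(k < n) F k * (if k == m :> nat then x else 0) = F m * x.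
  move=> lt_mn; rewrite (bigD1 (Ordinal lt_mn)) //= eqxx big1 ?addr0 // => k.
  by rewrite -val_eqE /= => /negPf ->; rewrite mulr0.
have up :
    \sum_(k < n) F k * (if k == j.+1 :> nat then u j else 0) = F j.+1 * u j.
  have [|le_nj] := ltnP j.+1 n; first exact: pick.
  have -> : u j = 0.
    rewrite -un0; congr u; rewrite [n in n.-1](_ : _ = j.+1) //.
    by apply/anti_leq; rewrite le_nj ltn_ord.
  by rewrite mulr0 big1 // => k _; rewrite if_same mulr0.
rewrite -up; case: j {up} => [[|j] lt_jn] /=.
  rewrite -pick // -big_split; apply: eq_bigr => k _ /=.
  rewrite /tridiag_entry andbT.
  by case: (k : nat) => [|[|m]] /=; rewrite ?mulr0 ?addr0 ?add0r.
rewrite -pick ?(ltnW lt_jn) // -big_split; apply: eq_bigr => k _ /=.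
rewrite /tridiag_entry andbF eqSS [j == k]eq_sym.
case: (k =P j.+2 :> nat) => [->|_]; last by rewrite mulr0 add0r.
by rewrite -[in X in X == j](addn2 j) -[X in _ == X]addn0 eqn_add2l mulr0 addr0.
Qed.

Variable s : C.
Hypothesis s_neq0 : s != 0.

Local Notation c := (s ^+ 2 + s ^- 2).

Lemma qcomm_inner n (A B : 'M[C]_n) :
  qcomm s B (qcomm s A B) = c *: (B *m A *m B) - (B *m B *m A + A *m B *m B).
Proof.
rewrite /qcomm !(mulmxBr, mulmxBl) -!(scalemxAl, scalemxAr) !scalerBr !scalerA.
rewrite mulVf // mulfV // !scale1r !mulmxA.
move: (B *m A *m B) (B *m B *m A) (A *m B *m B) => X Y Z.
by apply/matrixP => i j; rewrite !mxE -exprVn; ring.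
Qed.

Lemma qcomm_outer n (A B : 'M[C]_n) :
  qcomm s (qcomm s A B) A = c *: (A *m B *m A) - (A *m A *m B + B *m A *m A).
Proof.
rewrite /qcomm !(mulmxBr, mulmxBl) -!(scalemxAl, scalemxAr) !scalerBr !scalerA.
rewrite mulVf // mulfV // !scale1r !mulmxA.
move: (A *m B *m A) (A *m A *m B) (B *m A *m A) => X Y Z.
by apply/matrixP => i j; rewrite !mxE -exprVn; ring.
Qed.

(** The hypotheses on lam are what the entries of the cubic relations require at
    distance two (the recurrence) and one (the quadratic identity) from the
    diagonal. The two hypotheses on e are their analogues at the corner, with
    lam 0 in the place of the missing value lam (-1). The last hypothesis is the
    diagonal of the first cubic relation. *)
Lemma tridiagonal_representation n (lam u d : nat -> C) (e : C) :
    u n.-1 = 0 ->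
    (forall j, c * (lam j * lam j.+1) - (lam j ^+ 2 + lam j.+1 ^+ 2) = 1) ->
    (forall j, c * lam j.+1 = lam j + lam j.+2) ->
    e = e * ((c - 2) * lam 0%N ^+ 2) ->
    e * lam 1%N = e * ((c - 1) * lam 0%N) ->
    (forall j, (j < n)%N ->
      d j.+1 * u j * (c * lam j.+1 - lam j *+ 2) +
      (if j is j'.+1 then u j' * d j * (c * lam j' - lam j *+ 2)
       else e * e * ((c - 2) * lam 0%N)) = lam j) ->
  is_representation s (of_op12 s (diagonal n lam) (tridiagonal n u d e)).
Proof.
move=> un0 lam_step lam_rec e_diag e_rec diag_eq; split=> //=.
  rewrite qcomm_inner diagonalE; apply/matrixP => i j.
  (* Every entry of the cubic expression is a column sum of I_2, weighted by
     a row of I_2 and by the eigenvalues. *)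
  set F := fun k : nat => tridiag_entry u d e i k * (c * lam k - lam j - lam i).
  transitivity (\sum_(k < n) F k * tridiag_entry u d e k j).
    set A := diag_mx _; set B := tridiagonal n u d e.
    have BE k l : B k l = tridiag_entry u d e k l by rewrite mxE.
    have BAB : (B *m A *m B) i j = \sum_k B i k * lam k * B k j.
      by rewrite mul_mx_diag mxE; apply: eq_bigr => k _; rewrite !mxE.
    have BBA : (B *m B *m A) i j = \sum_k B i k * B k j * lam j.
      by rewrite mul_mx_diag !mxE mulr_suml.
    have ABB : (A *m B *m B) i j = \sum_k lam i * (B i k * B k j).
      by rewrite -mulmxA mul_diag_mx !mxE mulr_sumr.
    have entry (X Y Z : 'M[C]_n) :
        (c *: X - (Y + Z)) i j = c * X i j - (Y i j + Z i j).
      by rewrite !mxE.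
    rewrite entry BAB BBA ABB mulr_sumr -big_split -sumrB /=.
    apply: eq_bigr => k _; rewrite !BE /F; ring.
  rewrite sum_tridiagonal // /F /tridiag_entry !mxE -val_eqE {F}.
  case: i j => i lt_in [[|j] lt_jn] /=; rewrite ?andbF ?andbT.
    have /= diag_0 := diag_eq 0%N lt_jn.
    case: i {lt_in} => [|[|[|i]]] /=; rewrite ?mulr0n ?mulr1n.
    - by rewrite -[RHS]diag_0; ring.
    - by rewrite !mul0r add0r; ring: e_rec.
    - by rewrite !mul0r lam_rec; ring.
    - ring.
  have /= diag_j := diag_eq _ lt_jn.
  have [->|i_up] := eqVneq i j.+3.
    have -> : (j.+3 == j.+1) = false by lia.
    have -> : (j == j.+4) = false by lia.
    by rewrite mulr0n !mul0r addr0 lam_rec; ring.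
  have [->|i_mid] := eqVneq i j.+1.
    by rewrite eqxx mulr1n -[RHS]diag_j; ring.
  rewrite mulr0n; have -> : (j.+2 == i.+1) = false by lia.
  rewrite !mul0r add0r; have [->|i_down] := eqVneq j i.+1.
    by rewrite lam_rec; ring.
  have [/andP[/eqP -> /eqP ->]|_] := boolP (_ && _); last by rewrite !mul0r.
  ring: e_rec.
rewrite qcomm_outer diagonalE; apply/matrixP => i j.
rewrite -[diag_mx _ *m diag_mx _ *m _]mulmxA !mul_diag_mx !mul_mx_diag.
rewrite !mxE /tridiag_entry.
case: eqP => [->|_].
  rewrite -[RHS]mulr1 -(lam_step j); ring.
case: eqP => [->|_].
  rewrite -[RHS]mulr1 -(lam_step i); ring.
case: andP => [[/eqP -> /eqP ->]|_].
  by rewrite [RHS]e_diag; ring.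
by rewrite !(mul0r, mulr0) addr0 subr0.
Qed.

End Tridiagonal.

(** * The defining relations *)

Section Representations.
Variables (C : numClosedFieldType) (s : C).
Hypotheses (s_neq0 : s != 0) (D_neq0 : s ^ 2 - s ^ (- 2) != 0).

(** I_3 is quadratic in I_1 and I_2, so changing the sign of both leaves it
    fixed and the relations are preserved. *)
Lemma representation_sign n (A B : 'M[C]_n) (a : bool) :
  is_representation s (of_op12 s A B) ->
  is_representation s (of_op12 s ((-1) ^+ a *: A) ((-1) ^+ a *: B)).
Proof.
case: a; rewrite ?expr1 ?expr0 ?scale1r // !scaleN1r.
have qcommN2 (X Y : 'M[C]_n) : qcomm s (- X) (- Y) = qcomm s X Y.
  by rewrite /qcomm !mulmxN !mulNmx !opprK.
have qcommNl (X Y : 'M[C]_n) : qcomm s (- X) Y = - qcomm s X Y.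
  by rewrite /qcomm !mulmxN !mulNmx !scalerN -opprD.
have qcommNr (X Y : 'M[C]_n) : qcomm s X (- Y) = - qcomm s X Y.
  by rewrite /qcomm !mulmxN !mulNmx !scalerN -opprD.
case=> _ /= rel2 rel3; split; rewrite //= qcommN2.
  by rewrite qcommNl rel2.
by rewrite qcommNr rel3.
Qed.

Lemma qnumE d : qnum s d = (s ^ d - (s ^ d)^-1) / (s ^+ 2 - s ^- 2).
Proof. by rewrite /qnum invr_expz. Qed.

(** The form in which field produces the condition q^2 != 1. *)
Let s4_neq1 : (s * s) ^+ 2 - 1 != 0.
Proof.
have -> : (s * s) ^+ 2 - 1 = s ^+ 2 * (s ^+ 2 - s ^- 2) by field.
by rewrite mulf_neq0 ?expf_neq0 // exprnP invr_expz.
Qed.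

(** With x = q^(k-1/2) and y = q^n, passing from |k> to |k+1> multiplies x by q,
    so each condition is an identity of rational functions of s, x and y. *)
Lemma Ri_representation n (a b : bool) : (0 < n)%N ->
    (forall j, (j < n)%N -> (s ^+ (2 * j + 1)) ^+ 2 != 1) ->
  is_representation s (Ri s n a b).
Proof.
move=> n_gt0 odd_neq1; apply: representation_sign.
pose x j := s ^ hwt j; pose y := s ^ (2 * n)%N%:Z.
have x_neq0 j : x j != 0 by rewrite expfz_neq0.
have xS j : x j.+1 = s ^+ 2 * x j.
  by rewrite /x exprnP -expfzDr //; congr (_ ^ _); rewrite /hwt; lia.
have x0 : x 0%N = s by [].
have y_neq0 : y != 0 by rewrite expfz_neq0.
have upE j : s ^ (2 * (n%:Z - j.+1%:Z)) = y / (s * x j).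
  apply: (canRL (mulfK _)); first by rewrite mulf_neq0.
  rewrite /x /y -{2}[s]expr1z -!expfzDr //.
  by congr (s ^ _); rewrite /hwt; lia.
have downE j : s ^ (2 * (n%:Z + j.+1%:Z - 1)) = y * x j / s.
  apply: (canRL (mulfK _)) => //.
  rewrite /x /y -{2}[s]expr1z -!expfzDr //.
  by congr (s ^ _); rewrite /hwt; lia.
have y_last j : j.+1 = n -> y = s * x j.
  rewrite /x /y -{2}[s]expr1z -expfzDr // => <-.
  by congr (_ ^ _); rewrite /hwt; lia.
have x_sub j : (j < n)%N -> x j * x j - 1 != 0.
  by rewrite -expr2 subr_eq0; apply: odd_neq1.
pose D := s ^+ 2 - s ^- 2.
have -> : Ri_I1 s n = diagonal n (fun j => - ((x j + (x j)^-1) / D)).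
  by apply/matrixP => i j; rewrite !mxE -!invr_expz.
have -> : Ri_I2 s n b = tridiagonal n
    (fun j => 'i * ((y / (s * x j) - s * x j / y) / D / (x j - (x j)^-1)))
    (fun j => 'i * ((y * x j / s - s / (y * x j)) / D / (x j - (x j)^-1)))
    ((-1) ^+ b * ((y - y^-1) / D / (s - s^-1))).
  apply/matrixP => i j; rewrite !mxE /tridiag_entry !qnumE -!invr_expz.
  by rewrite upE downE !invf_div.
have up_last j : j.+1 = n -> y / (s * x j) - s * x j / y = 0.
  by move=> /y_last ->; rewrite divff ?subrr // mulf_neq0.
apply: tridiagonal_representation => //.
- by rewrite up_last ?prednK // !mul0r mulr0.
- move=> j; rewrite xS /D; field.
  by rewrite ?(s4_neq1, s_neq0, x_neq0).
- move=> j; rewrite !xS /D; field.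
  by rewrite ?(s4_neq1, s_neq0, x_neq0).
- rewrite x0 -[LHS]mulr1; congr (_ * _); rewrite /D; field.
  by rewrite ?(s4_neq1, s_neq0, x_neq0).
- rewrite xS x0; congr (_ * _); rewrite /D; field.
  by rewrite ?(s4_neq1, s_neq0, x_neq0).
have mul_ii (u v : C) : 'i * u * ('i * v) = - (u * v).
  by rewrite mulrACA -expr2 sqrCi mulN1r.
have sign_sqr (u v : C) : (-1) ^+ b * u * ((-1) ^+ b * v) = u * v.
  by rewrite mulrACA -expr2 sqrr_sign mul1r.
(* At the last index the entry towards |n+1> is zero and has to be dropped before
   clearing denominators, because q^(n+1/2) - q^(-n-1/2) may vanish. *)
case=> [|j] lt_jn; rewrite !mul_ii ?sign_sqr.
  have := x_sub _ lt_jn; have [n1|n_gt1] := eqVneq 1%N n.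
    rewrite up_last // (y_last 0%N) // !(mul0r, mulr0, oppr0, add0r) x0 /D.
    by move=> s2; field; rewrite s_neq0 s4_neq1 s2.
  have /x_sub : (1 < n)%N by lia.
  rewrite !xS x0 /D => x1 s2; field.
  by rewrite s_neq0 s4_neq1 s2 x1 y_neq0.
have := x_sub _ lt_jn; have /x_sub := ltnW lt_jn.
have [lastj|n_gt] := eqVneq j.+2 n.
  rewrite up_last // (y_last j.+1) // !(mul0r, mulr0, oppr0, add0r) !xS /D.
  by move=> x1 x2; field; rewrite s_neq0 s4_neq1 x1 x2 x_neq0.
have /x_sub : (j.+2 < n)%N by lia.
rewrite !xS /D => x3 x1 x2; field.
by rewrite s_neq0 s4_neq1 x1 x2 x3 x_neq0 y_neq0.
Qed.

(** Here w = q^m and y = q^l (so that w runs from 1/y to y). The condition on the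
    weights says that the denominators q^m + q^(-m) do not vanish. *)
Lemma R1_representation L :
    (forall j, (j <= L)%N -> (s ^ wt L j) ^+ 2 != -1) ->
  is_representation s (R1 s L).
Proof.
move=> wt_neqN1.
pose w j := s ^ wt L j; pose y := s ^ L%:Z.
have w_neq0 j : w j != 0 by rewrite expfz_neq0.
have wS j : w j.+1 = s ^+ 2 * w j.
  by rewrite /w exprnP -expfzDr //; congr (_ ^ _); rewrite /wt; lia.
have y_neq0 : y != 0 by rewrite expfz_neq0.
have upE j : s ^ (L%:Z - wt L j) = y / w j.
  by rewrite expfzDr // -invr_expz.
have downE j : s ^ (L%:Z + wt L j) = y * w j by rewrite expfzDr.
have w_first : w 0%N = y^-1.
  by rewrite /w /y invr_expz; congr (_ ^ _); rewrite /wt; lia.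
have w_last : w L = y by rewrite /w /y; congr (_ ^ _); rewrite /wt; lia.
have w_add j : (j <= L)%N -> w j * w j + 1 != 0.
  by rewrite -expr2 addr_eq0; apply: wt_neqN1.
pose D := s ^+ 2 - s ^- 2.
rewrite /R1; have -> : R1_I1 s L =
    diagonal L.+1 (fun j => 'i * ((w j - (w j)^-1) / D)).
  by apply/matrixP => i j; rewrite !mxE qnumE.
have -> : R1_I2 s L = tridiagonal L.+1
    (fun j => (y / w j - w j / y) / D / (w j + (w j)^-1))
    (fun j => - ((y * w j - (y * w j)^-1) / D) / (w j + (w j)^-1)) 0.
  apply/matrixP => i j; rewrite !mxE /tridiag_entry !qnumE -!invr_expz.
  by rewrite upE downE !invf_div !if_same.
have up_last : y / w L - w L / y = 0 by rewrite w_last subrr.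
have ii : 'i * 'i = -1 :> C by rewrite -expr2 sqrCi.
have ii_sub (u v z : C) :
    z * ('i * u * ('i * v)) - (('i * u) ^+ 2 + ('i * v) ^+ 2) =
    u ^+ 2 + v ^+ 2 - z * (u * v).
  by ring: ii.
apply: tridiagonal_representation => //.
- by rewrite up_last !mul0r.
- move=> j; rewrite ii_sub wS /D; field.
  by rewrite ?(s4_neq1, s_neq0, w_neq0).
- move=> j; rewrite !wS /D; field.
  by rewrite ?(s4_neq1, s_neq0, w_neq0).
- by rewrite mul0r.
- by rewrite !mul0r.
(* The two ends of the weight string are separate cases, because the
   denominators just outside it may vanish. *)
case=> [|j]; rewrite ltnS => lt_jL.
  have := w_add 0%N isT; have [L0|L_gt0] := posnP L.
    have y1 : y = 1 by rewrite /y L0.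
    by rewrite w_first y1 !invr1 !mulr1 !(subrr, mul0r, mulr0, addr0).
  have := w_add _ L_gt0; rewrite !wS w_first /D => w1 w0; field.
  rewrite s_neq0 s4_neq1 y_neq0 /=; apply/andP; split.
    have -> : 1 + y * y = y ^+ 2 * (y^-1 / y + 1) by field.
    by rewrite mulf_neq0 ?expf_neq0.
  have -> : (s * s) ^+ 2 + y * y =
      y ^+ 2 * (s ^+ 2 / y * (s ^+ 2 / y) + 1) by field.
  by rewrite mulf_neq0 ?expf_neq0.
have := w_add _ lt_jL; have /w_add := ltnW lt_jL.
have [lastj|j_lt] := eqVneq j.+1 L.
  have yE : y = s ^+ 2 * w j by rewrite -w_last -lastj wS.
  move: up_last; rewrite -lastj => ->.
  rewrite !(mul0r, mulr0, add0r) yE !wS /D => w0 w1; field.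
  by rewrite s_neq0 s4_neq1 w0 w1 w_neq0.
have /w_add : (j.+2 <= L)%N by lia.
rewrite !wS /D => w3 w1 w2; field.
by rewrite s_neq0 s4_neq1 y_neq0 w1 w2 w3 w_neq0.
Qed.

End Representations.

(** * Irreducibility from a simple spectrum *)

Section Irreducibility.

Variable C : numClosedFieldType.

(** Multiplying v by D - lam k for all k other than j, where D is the diagonal
    matrix, kills all its coordinates except the j-th. *)
Lemma delta_in_invariant n (lam : 'I_n -> C) (U : {vspace 'cV[C]_n}) v j :
    injective lam ->
    (forall v, v \in U -> diag_mx (\row_i lam i) *m v \in U) ->
  v \in U -> v j 0 != 0 -> delta_mx j 0 \in U.
Proof.
move=> lam_inj stabU Uv vj_neq0.
have filterU (r : seq 'I_n) :
    \col_i (\prod_(k <- r) (lam i - lam k) * v i 0) \in U.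
  elim: r => [|k r IHr].
    by rewrite (_ : \col_i _ = v) //; apply/colP => i; rewrite mxE big_nil mul1r.
  rewrite (_ : \col_i _ = diag_mx (\row_i lam i) *m
      (\col_i (\prod_(l <- r) (lam i - lam l) * v i 0)) -
      lam k *: \col_i (\prod_(l <- r) (lam i - lam l) * v i 0)).
    by rewrite memvB ?memvZ ?stabU.
  by apply/colP => i; rewrite mul_diag_mx !mxE big_cons -mulrBl mulrA.
pose r := [seq k <- enum 'I_n | k != j].
pose a := \prod_(k <- r) (lam j - lam k) * v j 0.
have a_neq0 : a != 0.
  rewrite mulf_neq0 // prodf_seq_neq0; apply/allP => k; rewrite mem_filter.
  by case/andP => k_neqj _ /=; rewrite subr_eq0 (inj_eq lam_inj) eq_sym.
have := memvZ a^-1 (filterU r); rewrite (_ : _ *: _ = delta_mx j 0) //.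
apply/colP => i; rewrite !mxE andbT; have [->|i_neqj] := eqVneq i j.
  by rewrite mulVf.
have ri : i \in r by rewrite mem_filter i_neqj mem_enum.
have uniq_r : uniq r by rewrite filter_uniq ?enum_uniq.
by rewrite (bigD1_seq i ri uniq_r) /= subrr !mul0r mulr0.
Qed.

(** An invariant subspace that is not zero contains some basis vector, and with a
    basis vector it contains the adjacent ones. *)
Lemma irreducible_diagonal_neighbours n (r : operators C n) (lam : 'I_n -> C) :
    (0 < n)%N -> injective lam -> op1 r = diag_mx (\row_i lam i) ->
    (forall i j : 'I_n, i = j.+1 :> nat -> op2 r i j != 0 /\ op2 r j i != 0) ->
  irreducible_rep r.
Proof.
move=> n_gt0 lam_inj op1E op2_neq0; split=> // U invU.
have stab1 v : v \in U -> diag_mx (\row_i lam i) *m v \in U.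
  by rewrite -op1E; case/invU.
have [->|U_neq0] := eqVneq U 0%VS; [by left | right].
have delta_step (i j : 'I_n) : op2 r i j != 0 ->
    delta_mx j 0 \in U -> delta_mx i 0 \in U.
  move=> Bij_neq0 /invU[_ Uj _]; apply: delta_in_invariant lam_inj stab1 Uj _.
  by rewrite -colE mxE.
have [j Uj] : exists j : 'I_n, delta_mx j 0 \in U.
  have: vpick U != 0 by rewrite vpick0.
  case/matrix0Pn => j [k]; rewrite (ord1 k) => vj_neq0.
  by exists j; apply: delta_in_invariant lam_inj stab1 (memv_pick U) vj_neq0.
have U0 : delta_mx (Ordinal n_gt0) 0 \in U.
  case: j Uj => j; elim: j => [|j IHj] lt_jn Uj.
    by congr (delta_mx _ _ \in _): Uj; apply: val_inj.
  apply: (IHj (ltnW lt_jn)); apply: delta_step Uj.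
  by have [] := op2_neq0 (Ordinal lt_jn) (Ordinal (ltnW lt_jn)).
have Uall (i : 'I_n) : delta_mx i 0 \in U.
  case: i => i; elim: i => [|i IHi] lt_in.
    by congr (delta_mx _ _ \in _): U0; apply: val_inj.
  apply: delta_step (IHi (ltnW lt_in)).
  by have [] := op2_neq0 (Ordinal lt_in) (Ordinal (ltnW lt_in)).
apply/eqP; rewrite eqEsubv subvf /=; apply/subvP => v _.
rewrite [v]matrix_sum_delta memv_suml // => i _; rewrite big_ord1.
by rewrite memvZ.
Qed.

End Irreducibility.

(** * Invariants of equivalence *)

Section Equivalence.

Variables (C : numClosedFieldType) (m n : nat).
Variables (r : operators C m) (r' : operators C n).

Lemma equivalent_dim : equivalent_rep r r' -> m = n.
Proof.
case=> T [T' [/mulmx1_min le_mn /mulmx1_min le_nm _]].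
by apply/anti_leq/andP.
Qed.

Lemma equivalent_trace :
  equivalent_rep r r' ->
  \tr (op1 r) = \tr (op1 r') /\ \tr (op2 r) = \tr (op2 r').
Proof.
case=> T [T' [T'T TT' [T1 T2 _]]].
have trE A A' : T *m A = A' *m T -> \tr A = \tr A'.
  by move=> TA; rewrite -[A]mul1mx -T'T -mulmxA TA mxtrace_mulC -mulmxA TT'
    mulmx1.
by split; apply: trE.
Qed.

End Equivalence.

Section Traces.
Variables (C : numClosedFieldType) (s : C).

Lemma trace_R1_I2 L : \tr (R1_I2 s L) = 0.
Proof.
rewrite /mxtrace big1 // => i _; rewrite mxE.
by rewrite (_ : (i == i.+1 :> nat) = false) //; lia.
Qed.

Lemma trace_Ri_I2 n b :
  \tr (Ri_I2 s n.+1 b) = (-1) ^+ b * (qnum s (2 * n.+1%:Z) / (s - s^-1)).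
Proof.
rewrite /mxtrace big_ord_recl big1 => [|i _].
  by rewrite addr0 mxE.
by rewrite mxE (_ : (lift ord0 i == (lift ord0 i).+1 :> nat) = false) //; lia.
Qed.

(** The sum of s^(2j+1) + s^(-2j-1) over j < n telescopes after multiplication by
    s - s^(-1). *)
Lemma trace_Ri_I1 n : s != 0 -> s - s^-1 != 0 ->
  \tr (Ri_I1 s n) = - (qnum s (2 * n%:Z) / (s - s^-1)).
Proof.
move=> s_neq0 s1; rewrite -mulNr; apply: (canRL (mulfK s1)).
rewrite /mxtrace /qnum; under eq_bigr => i _ do rewrite mxE eqxx.
elim: n => [|n IHn].
  by rewrite big_ord0 mul0r mulr0 expr0z subrr mul0r oppr0.
rewrite big_ord_recr mulrDl /= IHn -!invr_expz.
have -> : s ^ hwt n = s ^ (2 * n%:Z) * s.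
  by rewrite -{3}[s]expr1z -expfzDr //; congr (_ ^ _); rewrite /hwt; lia.
have -> : s ^ (2 * n.+1%:Z) = s ^ (2 * n%:Z) * s ^+ 2.
  by rewrite exprnP -expfzDr //; congr (_ ^ _); lia.
move: (s ^ (2 * n%:Z)) (expfz_neq0 (2 * n%:Z) s_neq0) => y y_neq0.
move: ((s ^ 2 - _)^-1) => z; field.
by rewrite s_neq0 y_neq0.
Qed.

End Traces.

(** * Roots of unity *)

Section RootsOfUnity.
Variables (C : numClosedFieldType) (s : C) (p : nat).
Hypotheses (hp3 : (3 <= p)%N) (hp : p.-primitive_root (s ^+ 2)).

Lemma root_neq0 : s != 0.
Proof.
apply/eqP => s0; have /eqP := prim_expr_order hp.
by rewrite s0 expr0n expr0n gtn_eqF ?(ltn_trans _ hp3) // eq_sym oner_eq0.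
Qed.
Let s_neq0 := root_neq0.

Lemma q_expr_neq1 k : (0 < k < p)%N -> s ^+ 2 ^+ k != 1.
Proof.
case/andP => k_gt0 lt_kp; rewrite -(prim_order_dvd hp).
by apply: contraL lt_kp => /dvdn_leq; rewrite -leqNgt; apply.
Qed.

Lemma nmax_bound : (2 * nmax p <= pprime p)%N /\ (2 * nmax p < p)%N.
Proof.
by rewrite /nmax /pprime; do 2![case: ifP => ?]; split; lia.
Qed.

(** p' is the order of q^2. *)
Lemma q_expr_double_neq1 k : (0 < k < pprime p)%N -> s ^+ 2 ^+ (2 * k) != 1.
Proof.
case/andP => k_gt0; rewrite -(prim_order_dvd hp) /pprime.
case: ifP => [odd_p|even_p] lt_kp.
  rewrite Gauss_dvdr ?coprimen2 //.
  by apply: contraL lt_kp => /dvdn_leq; rewrite -leqNgt; apply.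
apply: contraL lt_kp => /dvdn_leq; rewrite muln_gt0 k_gt0 => /(_ isT); lia.
Qed.

Lemma subV_neq0 (x : C) : x != 0 -> x ^+ 2 != 1 -> x - x^-1 != 0.
Proof.
move=> x_neq0; apply: contra; rewrite subr_eq0 => /eqP xV.
by rewrite expr2 {1}xV mulVf.
Qed.

Lemma q_sub_qV_neq0 : s ^ 2 - s ^ (- 2) != 0.
Proof.
rewrite -invr_expz subV_neq0 ?expfz_neq0 //.
by rewrite -exprnP q_expr_neq1 //; lia.
Qed.
Let D_neq0 := q_sub_qV_neq0.

Lemma s_subV_neq0 : s - s^-1 != 0.
Proof.
by rewrite subV_neq0 // -[s ^+ 2]expr1 q_expr_neq1 //; lia.
Qed.

Lemma qnum_double_neq0 k : (0 < k < pprime p)%N -> qnum s (2 * k%:Z) != 0.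
Proof.
move=> k_bound; rewrite /qnum mulf_neq0 ?invr_neq0 // -invr_expz.
rewrite subV_neq0 ?expfz_neq0 //.
have -> : s ^ (2 * k%:Z) = s ^+ (2 * k) by rewrite exprnP; congr (_ ^ _); lia.
by rewrite -exprM mulnC exprM q_expr_double_neq1.
Qed.

Lemma odd_power_sqr_neq1 n j :
  (n <= nmax p)%N -> (j < n)%N -> (s ^+ (2 * j + 1)) ^+ 2 != 1.
Proof.
move=> n_max lt_jn; have [_ nmax_p] := nmax_bound.
by rewrite -exprM mulnC exprM q_expr_neq1 //; lia.
Qed.

(** By the symmetry m -> -m one may take 2m >= 0. If q^(2m) = -1 then
    q^(4m) = 1, which is excluded for 0 < 2m < p'. *)
Lemma wt_power_sqr_neqN1 L j :
  (L <= (pprime p).-1)%N -> (j <= L)%N -> (s ^ wt L j) ^+ 2 != -1.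
Proof.
move=> L_max le_jL.
wlog: j le_jL / (L <= 2 * j)%N.
  move=> wlog_j; have [/wlog_j->//|/ltnW lt_2j] := leqP L (2 * j).
  have /(wlog_j _ (leq_subr j L)) : (L <= 2 * (L - j))%N by lia.
  have -> : wt L (L - j) = - wt L j by rewrite /wt; lia.
  by rewrite -invr_expz exprVn -[X in _ != X]invrN1 (inj_eq invr_inj).
move=> le_L2j.
have -> : wt L j = (2 * j - L)%N%:Z by rewrite /wt; lia.
rewrite -exprnP -exprM mulnC exprM; set k := (2 * j - L)%N.
have [->|k_gt0] := posnP k.
  by rewrite expr0 -subr_eq0 opprK -mulr2n pnatr_eq0.
have /q_expr_double_neq1 : (0 < k < pprime p)%N by rewrite k_gt0 /k; lia.
by apply: contra => /eqP qkN1; rewrite mulnC exprM qkN1 sqrrN expr1n.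
Qed.

(** x + 1/x and z x + 1/(z x) agree only if z = 1 or z x^2 = 1. Applied to
    z = q^(k'-k) and x = q^(k-1/2), the second equation reads q^(k+k'-1) = 1,
    and 0 < k + k' - 1 < p. *)
Lemma Ri_eigenvalues_inj n (a : bool) :
    (n <= nmax p)%N ->
  injective (fun i : 'I_n =>
    (-1) ^+ a * - ((s ^ hwt i + s ^ (- hwt i)) / (s ^ 2 - s ^ (- 2)))).
Proof.
move=> n_max; have [_ nmax_p] := nmax_bound.
suff inj_le (i j : 'I_n) : (i < j)%N ->
    s ^ hwt i + s ^ (- hwt i) != s ^ hwt j + s ^ (- hwt j).
  move=> i j /= /(mulfI (negbT (signr_eq0 _ _))) /oppr_inj.
  move=> /(mulIf (invr_neq0 D_neq0)) eq_ij.
  apply: val_inj; case: (ltngtP i j) => // lt_ij; move: (inj_le _ _ lt_ij);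
  by rewrite eq_ij eqxx.
move=> lt_ij; rewrite -!invr_expz; have lt_jn := ltn_ord j.
have -> : s ^ hwt j = s ^+ 2 ^+ (j - i) * s ^ hwt i.
  by rewrite -exprM exprnP -expfzDr //; congr (_ ^ _); rewrite /hwt; lia.
set z := s ^+ 2 ^+ (j - i); set x := s ^ hwt i.
have z_neq1 : z != 1 by rewrite q_expr_neq1 //; lia.
have z_neq0 : z != 0 by rewrite !expf_neq0.
have x_neq0 : x != 0 by rewrite expfz_neq0.
have zxx_neq1 : z * x ^+ 2 != 1.
  have -> : z * x ^+ 2 = s ^+ 2 ^+ (i + j + 1).
    rewrite /z -[x]/(s ^+ (2 * i + 1)) -!exprM -exprD.
    by congr (_ ^+ _); lia.
  by rewrite q_expr_neq1 //; lia.
rewrite -subr_eq0.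
have -> : x + x^-1 - (z * x + (z * x)^-1) =
    (1 - z) * (z * x ^+ 2 - 1) / (z * x).
  by field; rewrite x_neq0 z_neq0.
by rewrite !mulf_neq0 ?invr_neq0 ?mulf_neq0 // subr_eq0 // eq_sym.
Qed.

(** The relevant q-numbers are [n-k] and [n+k-1], whose arguments lie strictly
    between 0 and p' since 2n <= p'. *)
Lemma Ri_irreducible n (a b : bool) :
  (0 < n <= nmax p)%N -> irreducible_rep (Ri s n a b).
Proof.
case/andP => n_gt0 n_max; have [nmax_p' nmax_p] := nmax_bound.
apply: irreducible_diagonal_neighbours (Ri_eigenvalues_inj (a := a) n_max) _ _.
- by [].
- apply/matrixP => i j; rewrite !mxE; case: (i =P j) => [->|_] //.
  by rewrite mulr0.
have den_neq0 (k : 'I_n) : s ^ hwt k - s ^ (- hwt k) != 0.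
  rewrite -invr_expz subV_neq0 ?expfz_neq0 //.
  exact: odd_power_sqr_neq1 (ltn_ord k).
have coef_neq0 m (k : 'I_n) : (0 < m < pprime p)%N ->
    (-1) ^+ a * ('i * (qnum s (2 * m%:Z) / (s ^ hwt k - s ^ (- hwt k)))) != 0.
  move=> m_bound; apply: mulf_neq0; first by rewrite signr_eq0.
  apply: mulf_neq0; first exact: neq0Ci.
  by apply: mulf_neq0; [exact: qnum_double_neq0 | rewrite invr_neq0].
move=> i j ij; have lt_in := ltn_ord i; rewrite !mxE ij eqxx -ij.
rewrite (_ : (j == i.+1 :> nat) = false); last by lia.
split.
  rewrite (_ : n%:Z - _ = (n - i)%N%:Z); last by lia.
  by apply: coef_neq0; lia.
rewrite (_ : n%:Z + _ - 1 = (n + i)%N%:Z); last by lia.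
by apply: coef_neq0; lia.
Qed.

Lemma trace_neq0 n :
  (0 < n <= nmax p)%N -> qnum s (2 * n%:Z) / (s - s^-1) != 0.
Proof.
move=> n_bound; have [nmax_p' nmax_p] := nmax_bound.
rewrite mulf_neq0 ?invr_neq0 ?s_subV_neq0 // qnum_double_neq0 //; lia.
Qed.

(** The two traces recover both signs once t is known to be nonzero. *)
Lemma Ri_traces n (a b : bool) (t := qnum s (2 * n%:Z) / (s - s^-1)) :
    (0 < n)%N ->
  \tr (op1 (Ri s n a b)) = - ((-1) ^+ a * t) /\
  \tr (op2 (Ri s n a b)) = (-1) ^+ a * ((-1) ^+ b * t).
Proof.
move=> n_gt0; rewrite /= !mxtraceZ trace_Ri_I1 ?s_subV_neq0 // mulrN.
split=> //.
by rewrite /t; case: n n_gt0 @t => // n _ _; rewrite trace_Ri_I2.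
Qed.

Lemma Ri_nonequivalent n n' (a a' b b' : bool) :
    (0 < n <= nmax p)%N -> equivalent_rep (Ri s n a b) (Ri s n' a' b') ->
  (n, a, b) = (n', a', b').
Proof.
move=> n_bound eqv; have nn' := equivalent_dim eqv; rewrite -nn' in eqv *.
have n_gt0 : (0 < n)%N by case/andP: n_bound.
have t_neq0 := trace_neq0 n_bound.
have [] := equivalent_trace eqv.
have [-> ->] := Ri_traces a b n_gt0; have [-> ->] := Ri_traces a' b' n_gt0.
move=> /oppr_inj /(mulIf t_neq0) /signr_inj ->.
by move=> /(mulfI (negbT (signr_eq0 _ _))) /(mulIf t_neq0) /signr_inj ->.
Qed.

Lemma R1_Ri_nonequivalent L n (a b : bool) :
  (0 < n <= nmax p)%N -> ~ equivalent_rep (R1 s L) (Ri s n a b).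
Proof.
move=> n_bound /equivalent_trace[_]; rewrite [LHS]trace_R1_I2.
have [_ ->] := Ri_traces a b (proj1 (andP n_bound)).
move/esym/eqP; rewrite !(mulf_eq0 ((-1) ^+ _)) !signr_eq0.
by rewrite (negPf (trace_neq0 n_bound)).
Qed.

End RootsOfUnity.

Theorem theorem5 (R : realType) (q s : R[i]) (p : nat)
    (hs : s ^+ 2 = q) (hp3 : (3 <= p)%N) (hp : p.-primitive_root q) :
  [/\ forall (n : nat) (a b : bool), (1 <= n <= nmax p)%N ->
        is_representation s (Ri s n a b) /\ irreducible_rep (Ri s n a b),
      forall (n n' : nat) (a a' b b' : bool),
        (1 <= n <= nmax p)%N -> (1 <= n' <= nmax p)%N ->
        (n, a, b) <> (n', a', b') ->
        ~ equivalent_rep (Ri s n a b) (Ri s n' a' b')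
    & forall L : nat, (L <= (pprime p).-1)%N ->
        is_representation s (R1 s L) /\
        forall (n : nat) (a b : bool), (1 <= n <= nmax p)%N ->
          ~ equivalent_rep (R1 s L) (Ri s n a b)].
Proof.
subst q.
have s_neq0 := root_neq0 hp3 hp; have D_neq0 := q_sub_qV_neq0 hp3 hp.
split=> [n a b n_bound|n n' a a' b b' n_bound _ neq|L L_max]; last split.
- split; last exact: Ri_irreducible n_bound.
  case/andP: n_bound => n_gt0 n_max.
  by apply: Ri_representation => // j; apply: odd_power_sqr_neq1 n_max.
- by move=> /(Ri_nonequivalent hp3 hp n_bound).
- by apply: R1_representation => // j; apply: wt_power_sqr_neqN1 L_max.
by move=> n a b; apply: R1_Ri_nonequivalent.
Qed.
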